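(* Let $\mathfrak{L}$ be a linearly ordered idempotent semifield with $\mathfrak{L}\neq\mathbb{B}$. The generalised regularity properties of $UT_n(\mathfrak{L}^* )$ and $U_n(\mathfrak{L}^* )$ are as follows. (1) $UT_1(\mathfrak{L}^* )$ is regular (and a group); $UT_2(\mathfrak{L}^* )$ is regular (and an inverse semigroup); and for all $n\geq 3$, $UT_n(\mathfrak{L}^* )$ is Fountain but neither regular nor abundant. (2) $U_1(\mathfrak{L}^* )$ is regular (and a group); $U_2(\mathfrak{L}^* )$ is regular (and a semilattice); and for all $n\geq 3$, $U_n(\mathfrak{L}^* )$ is Fountain but neither regular nor abundant.
   Context: A linearly ordered idempotent semifield is a commutative semiring $\mathfrak{L}$ with $x+x=x$ for all $x$, in which $\mathfrak{L}^*=\mathfrak{L}\setminus\{\mathbf{0}\}$ is an abelian group under multiplication with identity $\mathbf{1}$, and in which the order $a\leq b\iff a+b=b$ is total (so $\mathfrak{L}^*$ is a linearly ordered abelian group and addition is maximum). $\mathbb{B}$ is the Boolean semifield $\{\mathbf{0},\mathbf{1}\}$; thus $\mathfrak{L}\neq\mathbb{B}$ means $\mathfrak{L}^*$ is non-trivial. $UT_n(\mathfrak{L}^* )$ is the semigroup (under matrix multiplication) of upper triangular $n\times n$ matrices over $\mathfrak{L}$ all of whose entries on and above the diagonal are non-zero; $U_n(\mathfrak{L}^* )$ is the subsemigroup of those with all diagonal entries $\mathbf{1}$. For a semigroup $T$ let $T^1$ be $T$ with an identity adjoined if necessary. $T$ is regular if for each $a\in T$ there is $x\in T$ with $axa=a$.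 Define $a\,\mathcal{R}^*\,b$ iff for all $x,y\in T^1$: $xa=ya\Leftrightarrow xb=yb$; $a\,\mathcal{L}^*\,b$ iff for all $x,y\in T^1$: $ax=ay\Leftrightarrow bx=by$; $a\,\widetilde{\mathcal{R}}\,b$ iff for all idempotents $e\in T$: $ea=a\Leftrightarrow eb=b$; $a\,\widetilde{\mathcal{L}}\,b$ iff for all idempotents $e\in T$: $ae=a\Leftrightarrow be=b$. $T$ is abundant if every $\mathcal{R}^*$-class and every $\mathcal{L}^*$-class contains an idempotent, and Fountain if every $\widetilde{\mathcal{R}}$-class and every $\widetilde{\mathcal{L}}$-class contains an idempotent. *)

(* Defs.v *)
From HB Require Import structures.
From mathcomp Require Import all_boot all_order all_algebra.

Set Implicit Arguments.
Unset Strict Implicit.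
Unset Printing Implicit Defensive.

Import GRing.Theory.

Section Semigroups.
Local Open Scope group_scope.
Variable T : semigroupType.
Implicit Types (a b e : T) (x y : option T) (r : T -> T -> Prop).

Definition idem e : Prop := e * e = e.

Definition is_identity e : Prop := forall a, e * a = a /\ a * e = a.

(* [option T] is T with a new identity [None]; [T^1] is all of it when T has
   no identity, and only the image of [Some] otherwise. *)
Definition mul1 x y : option T :=
  match x, y with
  | Some a, Some b => Some (a * b)
  | None, _ => y
  | _, None => x
  end.

Definition in_T1 x : Prop :=
  if x is None then ~ exists e, is_identity e else True.

Definition Rstar a b : Prop := forall x y, in_T1 x -> in_T1 y ->
  (mul1 x (Some a) = mul1 y (Some a) <-> mul1 x (Some b) = mul1 y (Some b)).

Definition Lstar a b : Prop := forall x y, in_T1 x -> in_T1 y ->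
  (mul1 (Some a) x = mul1 (Some a) y <-> mul1 (Some b) x = mul1 (Some b) y).

Definition Rtilde a b : Prop := forall e, idem e -> (e * a = a <-> e * b = b).

Definition Ltilde a b : Prop := forall e, idem e -> (a * e = a <-> b * e = b).

Definition each_class_has_idem r : Prop := forall a, exists2 e, idem e & r a e.

Definition regular : Prop := forall a, exists x : T, a * x * a = a.

Definition abundant : Prop :=
  each_class_has_idem Rstar /\ each_class_has_idem Lstar.

Definition Fountain : Prop :=
  each_class_has_idem Rtilde /\ each_class_has_idem Ltilde.

Definition is_group : Prop :=
  exists2 e, is_identity e & forall a, exists b, a * b = e /\ b * a = e.

Definition is_inverse_semigroup : Prop :=
  forall a, exists! b, a * b * a = a /\ b * a * b = b.

Definition is_semilattice : Prop :=
  (forall a b, a * b = b * a) /\ (forall a, idem a).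

End Semigroups.

Arguments regular : clear implicits.
Arguments abundant : clear implicits.
Arguments Fountain : clear implicits.
Arguments is_group : clear implicits.
Arguments is_inverse_semigroup : clear implicits.
Arguments is_semilattice : clear implicits.

Local Open Scope ring_scope.

HB.mixin Record isLinOrdIdemSemifield L of GRing.ComNzSemiRing L := {
  addLL : forall a : L, a + a = a;
  mulL_inv : forall a : L, a != 0 -> exists b : L, b * a = 1;
  (* totality of the order a <= b iff a + b = b *)
  leL_total : forall a b : L, a + b = b \/ b + a = a
}.

#[short(type="linOrdIdemSemifieldType")]
HB.structure Definition LinOrdIdemSemifield :=
  {L of isLinOrdIdemSemifield L & GRing.ComNzSemiRing L}.

Section SemifieldFacts.
Variable L : linOrdIdemSemifieldType.
Implicit Types a b : L.

Lemma addL_neq0 a b : a != 0 -> a + b != 0.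
Proof.
by apply: contraNneq => ab0; rewrite -[a]addr0 -ab0 addrA addLL ab0.
Qed.

Lemma mulL_neq0 a b : a != 0 -> b != 0 -> a * b != 0.
Proof.
move=> /mulL_inv[c ca1]; apply: contraNneq => ab0.
by rewrite -[b]mul1r -ca1 -mulrA ab0 mulr0.
Qed.

End SemifieldFacts.

Section UpperTriangular.
Variables (L : linOrdIdemSemifieldType) (n : nat).

Definition is_UT (A : 'M[L]_n) : bool :=
  [forall i : 'I_n, forall j : 'I_n, (A i j != 0) == (i <= j)%N].

Lemma is_UTP (A : 'M[L]_n) :
  reflect (forall i j : 'I_n, (A i j != 0) = (i <= j)%N) (is_UT A).
Proof.
apply: (iffP forallP) => [A_UT i j | A_UT i].
  by move/(_ i)/forallP/(_ j)/eqP: A_UT.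
by apply/forallP => j; apply/eqP.
Qed.

Lemma mulmx_UT (A B : 'M[L]_n) : is_UT A -> is_UT B -> is_UT (A *m B).
Proof.
move=> /is_UTP A_UT /is_UTP B_UT; apply/is_UTP => i j; rewrite mxE.
have [le_ij | lt_ji] := leqP i j.
  rewrite (bigD1 i) //= addL_neq0 // mulL_neq0 ?A_UT ?B_UT //.
rewrite big1 ?eqxx // => k _.
have [le_ik | lt_ki] := leqP i k.
  have /eqP-> : B k j == 0.
    by rewrite -[_ == 0]negbK B_UT -ltnNge (leq_trans lt_ji).
  by rewrite mulr0.
have /eqP-> : A i k == 0 by rewrite -[_ == 0]negbK A_UT -ltnNge.
by rewrite mul0r.
Qed.

Record UT : Type := MkUT { UT_mx :> 'M[L]_n; _ : is_UT UT_mx }.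

HB.instance Definition _ := [isSub for UT_mx].
HB.instance Definition _ := [Choice of UT by <:].

Definition UT_mul (A B : UT) : UT := MkUT (mulmx_UT (valP A) (valP B)).

Lemma UT_mulA : associative UT_mul.
Proof. by move=> A B C; apply: val_inj; rewrite /= mulmxA. Qed.

HB.instance Definition _ := isSemigroup.Build UT UT_mulA.

Definition unidiagonal (A : UT) : bool := [forall i : 'I_n, A i i == 1].

Lemma unidiagonal_mul_closed : mulg_closed unidiagonal.
Proof.
move=> A B /forallP A1 /forallP B1; apply/forallP => i.
have /is_UTP A_UT := valP A; have /is_UTP B_UT := valP B.
rewrite mxE (bigD1 i) //= (eqP (A1 i)) (eqP (B1 i)) mulr1 big1 ?addr0 //.
move=> k neq_ki; have [lt_ik | lt_ki | /val_inj eq_ki] := ltngtP i k.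
- have /eqP-> : B k i == 0 by rewrite -[_ == 0]negbK B_UT -ltnNge.
  by rewrite mulr0.
- have /eqP-> : A i k == 0 by rewrite -[_ == 0]negbK A_UT -ltnNge.
  by rewrite mul0r.
- by rewrite eq_ki eqxx in neq_ki.
Qed.

Record U : Type := MkU { U_UT :> UT; _ : unidiagonal U_UT }.

HB.instance Definition _ := [isSub for U_UT].
HB.instance Definition _ := [Choice of U by <:].
HB.instance Definition _ :=
  SubChoice_isSubSemigroup.Build UT unidiagonal U unidiagonal_mul_closed.

End UpperTriangular.

(* Main.v *)
Require Import Defs.
From mathcomp Require Import all_boot all_order all_algebra.

Set Implicit Arguments.
Unset Strict Implicit.
Unset Printing Implicit Defensive.

Import GRing.Theory.

(** Over [L] addition is the maximum of a total order, written [a <=+ b] below,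
so matrices form an idempotent semiring ordered entrywise in which products are
monotone.  An idempotent [F] of [UT L n] has diagonal [1]: hence it lies in
[U L n], and [F A >= A] for every [A].

The Fountain property comes from residuation.  Given [A], there is a largest
triangular matrix [E] with [E A <= A], with entries
[E i k = min_(j >= k) A i j / A k j] (lemma [le_residualP]).  Maximality forces
[E E = E] and [E A = A], and an idempotent [F] fixes [A] iff [F A <= A] iff
[F <= E] iff [F E = E]; so [E] is an idempotent in the R-tilde class of [A]
(lemma [exists_left_stabiliser]).  The L-tilde classes follow by transposition,
for which reason the residual is studied for an arbitrary preorder on the
indices rather than for the natural order only.

For [n = 2] the semigroup [U L 2] is the semilattice of [(L^*, max)], so the
idempotents of [UT L 2] commute; as [UT L 2] is regular, it is inverse.

For [n >= 3] pick [g > 1] and let [A] have diagonal [1] and all entries [g]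
above the diagonal.  This [A] is not idempotent, because [A A] has the entry
[g^2] in position (0, 2).  If [A B A = A] then [B] has diagonal [1] and
[A B A >= A A], a contradiction, so [A] is not regular.  If an idempotent [e]
were R-star related to [A], then [e A = A], and looking at position (0, 2)
gives [e 0 1 <= 1 < g = A 0 1].  So take two matrices that differ only in their
(0, 1) entries, [1] and [g], and whose other entries above the diagonal are
large: multiplying [A] by them on the left gives the same product, but
multiplying [e] gives different ones ([not_abundant_witness_eq] and
[not_abundant_witness_neq]).  All matrices involved lie in [U L n], which
settles both families at once. *)

Local Open Scope ring_scope.

(** * Semigroups *)

Section AbstractSemigroups.
Local Open Scope group_scope.
Variable T : semigroupType.
Implicit Types a b c : T.

Lemma group_regular : is_group T -> regular T.
Proof.
by case=> e e1 inv a; have [b [ab _]] := inv a; exists b; rewrite ab (e1 a).1.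
Qed.

(** If [b] and [c] are inverses of [a], commuting [ac] past [ab] gives
[b = bac], and commuting [ca] past [ba] gives [c = bac]. *)
Lemma regular_idem_comm_inverse : regular T ->
  (forall e f : T, idem e -> idem f -> e * f = f * e) -> is_inverse_semigroup T.
Proof.
move=> reg comm a; have [x axa] := reg a.
have axaK z : z * a * x * a = z * a by rewrite -!mulgA (mulgA a x a) axa.
have [b [aba bab]] : exists b, a * b * a = a /\ b * a * b = b.
  by exists (x * a * x); rewrite !mulgA !axaK axa.
exists b; split=> // c [aca cac].
have ab_ac : a * c * (a * b) = a * b * (a * c).
  by apply: comm; rewrite /idem !mulgA ?aba ?aca.
have ca_ba : c * a * (b * a) = b * a * (c * a).
  by apply: comm; rewrite /idem !mulgA ?bab ?cac.
have -> : b = b * a * c.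
  rewrite -{1}bab -{1}aca.
  have -> : b * (a * c * a) * b = b * (a * c * (a * b)) by rewrite !mulgA.
  by rewrite ab_ac !mulgA bab.
have {2}-> // : c = b * a * c.
rewrite -{1}cac -{1}aba.
have -> : c * (a * b * a) * c = c * a * (b * a) * c by rewrite !mulgA.
by rewrite ca_ba -!mulgA (mulgA c a c) cac.
Qed.

Lemma semilattice_regular : is_semilattice T -> regular T.
Proof. by case=> _ id a; exists a; rewrite !id. Qed.

(** The relation compares [c * a] with [1 * a].  When [T] already has an
identity, that element stands in for the adjoined one; equality in [T] is
decidable, so the two cases can be separated when arguing by contradiction. *)
Lemma Rstar_fixed a b c : Rstar a b -> c * a = a -> c * b = b.
Proof.
move=> ab ca; apply/eqP; apply: contraT => /eqP cb.
have no_id : ~ exists e : T, is_identity e.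
  case=> u u1; apply: cb; have [+ _] := ab (Some c) (Some u) I I.
  by rewrite /= ca (u1 a).1 (u1 b).1 => /(_ erefl) [].
have [+ _] := ab (Some c) None I no_id.
by rewrite /= ca => /(_ erefl) [].
Qed.

Lemma Rstar_sym a b : Rstar a b -> Rstar b a.
Proof. by move=> ab x y x1 y1; apply: iff_sym; apply: ab. Qed.

(** An idempotent [e] in the R-star class of [a] fixes [a], since it fixes
itself; so it is enough to consider idempotents that fix [a]. *)
Lemma not_abundant a :
  (forall e, idem e -> e * a = a ->
     exists x, exists2 y, x * a = y * a & x * e <> y * e) ->
  ~ abundant T.
Proof.
move=> sep [/(_ a) [e ee ae] _].
have [x [y xy]] := sep e ee (Rstar_fixed (Rstar_sym ae) ee); apply.
by have [+ _] := ae (Some x) (Some y) I I; rewrite /= xy => /(_ erefl) [].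
Qed.

End AbstractSemigroups.

(** * The natural order of an idempotent additive monoid *)

Definition le_add (V : nmodType) (a b : V) : Prop := a + b = b.

Notation "a <=+ b" := (le_add a b) (at level 70, no associativity).

Section NaturalOrder.
Variable V : nmodType.
Implicit Types a b c : V.

Lemma le_add_trans b a c : a <=+ b -> b <=+ c -> a <=+ c.
Proof. by rewrite /le_add => ab bc; rewrite -bc addrA ab. Qed.

Lemma le_add_anti a b : a <=+ b -> b <=+ a -> a = b.
Proof. by rewrite /le_add => ab ba; rewrite -ba addrC. Qed.

Lemma le0_add a : 0 <=+ a.
Proof. exact: add0r. Qed.

Lemma sum_le_add (I : finType) (F : I -> V) b :
  (forall i, F i <=+ b) -> \sum_i F i <=+ b.
Proof.
move=> leF; apply: (big_ind (fun x => x <=+ b)) => // [|x y xb yb].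
  exact: le0_add.
by rewrite /le_add -addrA yb.
Qed.

End NaturalOrder.

(** * Order and division in the semifield *)

Section Semifield.
Variable L : linOrdIdemSemifieldType.
Implicit Types a b c : L.

Lemma le_add_refl a : a <=+ a.
Proof. exact: addLL. Qed.

Lemma le_add_sum (I : finType) (F : I -> L) i : F i <=+ \sum_j F j.
Proof. by rewrite /le_add (bigD1 i) //= addrA addLL. Qed.

Lemma sum_le_addP (I : finType) (F : I -> L) b :
  \sum_i F i <=+ b <-> forall i, F i <=+ b.
Proof.
split=> [le_b i | ]; last exact: sum_le_add.
exact: le_add_trans (le_add_sum F i) le_b.
Qed.

Lemma le_add_mul2l c a b : a <=+ b -> c * a <=+ c * b.
Proof. by rewrite /le_add -mulrDr => ->. Qed.

Lemma le_add_mul2r c a b : a <=+ b -> a * c <=+ b * c.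
Proof. by rewrite /le_add -mulrDl => ->. Qed.

Lemma invL_exists a : exists b, if a == 0 then b == 0 else b * a == 1.
Proof.
have [_ | /mulL_inv [b ba]] := eqVneq a 0; first by exists 0.
by exists b; apply/eqP.
Qed.

(** Total inverse with [invL 0 = 0], so that a sum of quotients may range over
zero denominators. *)
Definition invL a : L := xchoose (invL_exists a).

Lemma invLP a : if a == 0 then invL a == 0 else invL a * a == 1.
Proof. exact: xchooseP (invL_exists a). Qed.

Lemma invL0 : invL 0 = 0.
Proof. by apply/eqP; have := invLP 0; rewrite eqxx. Qed.

Lemma mulVL a : a != 0 -> invL a * a = 1.
Proof. by move=> /negPf a0; apply/eqP; have := invLP a; rewrite a0. Qed.

Lemma mulLV a : a != 0 -> a * invL a = 1.
Proof. by rewrite mulrC; apply: mulVL. Qed.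

Lemma invL_neq0 a : a != 0 -> invL a != 0.
Proof.
by move=> /mulVL; apply: contra_eq_neq => ->; rewrite mul0r eq_sym oner_neq0.
Qed.

Lemma mulLI c a b : c != 0 -> c * a = c * b -> a = b.
Proof.
by move=> c0 e; rewrite -[a]mul1r -[b]mul1r -(mulVL c0) -!mulrA e.
Qed.

Lemma le_add_pmul2r c a b : c != 0 -> a * c <=+ b * c -> a <=+ b.
Proof.
by move=> c0 /(le_add_mul2r (invL c)); rewrite -!mulrA mulLV // !mulr1.
Qed.

Lemma le_invLP a s : s != 0 -> a <=+ invL s <-> a * s <=+ 1.
Proof.
move=> s0; split=> [/(le_add_mul2r s) | as1]; first by rewrite mulVL.
by apply: (le_add_pmul2r s0); rewrite mulVL.
Qed.

Lemma idem_eq1 a : a != 0 -> a * a = a -> a = 1.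
Proof. by move=> a0 aa; apply: (mulLI a0); rewrite mulr1. Qed.

Lemma exists_gt1 :
  (exists x : L, x != 0 /\ x != 1) -> exists g : L, 1 <=+ g /\ g != 1.
Proof.
case=> x [x0 x1]; have [le1x | lex1] := leL_total 1 x; first by exists x.
exists (invL x); split; first by apply/(le_invLP _ x0); rewrite mul1r.
by apply: contraNneq x1 => v1; rewrite -(mulVL x0) v1 mul1r.
Qed.

(** * Residuation of matrices *)

Section Matrices.
Variable n : nat.
Implicit Types (A B F : 'M[L]_n) (r : rel 'I_n).

Lemma le_mxP A B : A <=+ B <-> forall i j, A i j <=+ B i j.
Proof.
split=> [leAB i j | leAB]; last by apply/matrixP => i j; rewrite mxE leAB.
by rewrite /le_add -{2}leAB mxE.
Qed.

Lemma le_mx_refl A : A <=+ A.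
Proof. by apply/le_mxP => i j; apply: le_add_refl. Qed.

Lemma le_mulmx2r F A B : A <=+ B -> A *m F <=+ B *m F.
Proof. by rewrite /le_add -mulmxDl => ->. Qed.

Lemma mulmx_le_addP F A B :
  F *m A <=+ B <-> forall i k j, F i k * A k j <=+ B i j.
Proof.
split=> [/le_mxP FAB i k j | FAB].
  by have := FAB i j; rewrite mxE => /sum_le_addP.
by apply/le_mxP => i j; rewrite mxE; apply/sum_le_addP => k; apply: FAB.
Qed.

Lemma le_add_mulmx F A i k j : F i k * A k j <=+ (F *m A) i j.
Proof. by move: i k j; apply/mulmx_le_addP/le_mx_refl. Qed.

Definition has_pattern r A : Prop := forall i j, (A i j != 0) = r i j.

Lemma pattern0 r A i j : has_pattern r A -> ~~ r i j -> A i j = 0.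
Proof. by move=> rA; rewrite -rA => /negPn/eqP. Qed.

(** The residual [A / A]: on the support of [r] its (i, k) entry is the minimum
of the [A i j / A k j], written as the inverse of the maximum of the inverses.
Where [A k j] is zero the summand vanishes, as it should. *)
Definition residual r A : 'M[L]_n := \matrix_(i, k)
  if r i k then invL (\sum_j A k j * invL (A i j)) else 0.

Section Residual.
Variables (r : rel 'I_n) (A : 'M[L]_n).
Hypotheses (r_refl : reflexive r) (r_trans : transitive r).
Hypothesis rA : has_pattern r A.

Lemma residual_sum_neq0 i k : r i k -> \sum_j A k j * invL (A i j) != 0.
Proof.
move=> rik; rewrite (bigD1 k) //= addL_neq0 // mulL_neq0 ?rA //.
by rewrite invL_neq0 ?rA.
Qed.

Lemma residual_pattern : has_pattern r (residual r A).
Proof.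
move=> i k; rewrite mxE; case: ifP => [rik | _]; last by rewrite eqxx.
by rewrite invL_neq0 ?residual_sum_neq0.
Qed.

(** The residual is the largest matrix with the pattern of [r] that satisfies
[F A <= A]; every property of it used below follows from this one. *)
Lemma le_residualP F : (forall i k, ~~ r i k -> F i k = 0) ->
  F *m A <=+ A <-> F <=+ residual r A.
Proof.
move=> F0; split=> [/mulmx_le_addP FA | /le_mxP FE].
  apply/le_mxP => i k; rewrite mxE; case: ifPn => [rik | /F0 ->]; last first.
    exact: le0_add.
  apply/le_invLP; first exact: residual_sum_neq0.
  rewrite mulr_sumr; apply/sum_le_addP => j; rewrite mulrA.
  have [-> | Aij] := eqVneq (A i j) 0.
    by rewrite invL0 mulr0; apply: le0_add.
  by rewrite -(mulLV Aij); apply: le_add_mul2r; apply: FA.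
apply/mulmx_le_addP => i k j.
have [rik | /F0 ->] := boolP (r i k); last by rewrite mul0r; apply: le0_add.
have [rkj | /(pattern0 rA) ->] := boolP (r k j); last first.
  by rewrite mulr0; apply: le0_add.
have Aij : A i j != 0 by rewrite rA (r_trans rik).
have := FE i k; rewrite mxE rik => /(le_invLP _ (residual_sum_neq0 rik)).
rewrite mulr_sumr => /sum_le_addP/(_ j)/(le_add_mul2r (A i j)).
by rewrite -!mulrA mulVL // mulr1 mul1r.
Qed.

(** For [F >= 1], fixing [A] means [F A <= A], that is [F <= E]; and as [E] is
idempotent this also means [F E = E]. *)
Lemma exists_left_stabiliser : exists E : 'M[L]_n,
  [/\ has_pattern r E, 1%:M <=+ E, E *m E = E &
      forall F, has_pattern r F -> 1%:M <=+ F -> F *m A = A <-> F *m E = E].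
Proof.
pose E := residual r A; have rE := residual_pattern.
have below F : has_pattern r F -> F *m A <=+ A <-> F <=+ E.
  by move=> rF; apply: le_residualP => i k; apply: pattern0.
have leEA : E *m A <=+ A by apply/(below E rE)/le_mx_refl.
(* Both [1] and [E E] satisfy the inequality of which [E] is the largest
   solution. *)
have le1E : 1%:M <=+ E.
  apply/le_residualP; last by rewrite mul1mx; apply: le_mx_refl.
  by move=> i k; rewrite mxE; case: eqP => // ->; rewrite r_refl.
have EA : E *m A = A.
  by apply: le_add_anti leEA _; rewrite -{1}[A]mul1mx; apply: le_mulmx2r.
have EE : E *m E = E.
  apply: le_add_anti; last by rewrite -{1}[E]mul1mx; apply: le_mulmx2r.
  apply/le_residualP; last by rewrite -mulmxA EA.
  move=> i k rik; rewrite mxE big1 // => j _.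
  have [rij | /(pattern0 rE) ->] := boolP (r i j); last by rewrite mul0r.
  by rewrite (pattern0 (i := j) rE) ?mulr0 //;
    apply: contraNN rik => /(r_trans rij).
exists E; split=> // F rF le1F; split=> [FA | FE].
  apply: le_add_anti.
    rewrite -{2}EE; apply/le_mulmx2r/below => //.
    by rewrite FA; apply: le_mx_refl.
  by rewrite -{1}[E]mul1mx; apply: le_mulmx2r.
by rewrite -EA mulmxA FE.
Qed.

End Residual.
End Matrices.

(** Transposition reverses products because [L] is commutative, and replaces
the preorder by its converse. *)
Lemma exists_right_stabiliser n (r : rel 'I_n) (A : 'M[L]_n) :
  reflexive r -> transitive r -> has_pattern r A ->
  exists E : 'M[L]_n,
  [/\ has_pattern r E, 1%:M <=+ E, E *m E = E &
      forall F, has_pattern r F -> 1%:M <=+ F -> A *m F = A <-> E *m F = E].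
Proof.
move=> r_refl r_trans rA.
have tr_pattern (s : rel 'I_n) (B : 'M[L]_n) :
    has_pattern s B -> has_pattern (fun i j => s j i) B^T.
  by move=> sB i j; rewrite mxE sB.
have tr_ge1 (B : 'M[L]_n) : 1%:M <=+ B -> 1%:M <=+ B^T.
  move/le_mxP=> leB; apply/le_mxP => i j.
  by have := leB j i; rewrite !mxE eq_sym.
have [E [rE le1E EE stabE]] := @exists_left_stabiliser n
  (fun i j => r j i) A^T r_refl
  (fun j i k rij rjk => r_trans j k i rjk rij) (tr_pattern _ _ rA).
exists E^T; split; first exact: tr_pattern rE.
- exact: tr_ge1.
- by rewrite -trmx_mul EE.
move=> F rF le1F; have := stabE F^T (tr_pattern _ _ rF) (tr_ge1 _ le1F).
rewrite -trmx_mul -{1}[E]trmxK -trmx_mul => FAE.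
by split=> [FA | FE]; apply: trmx_inj; rewrite ?trmxK; apply/FAE;
  rewrite ?FA ?FE ?trmxK.
Qed.

(** * Triangular matrices and the Fountain property *)

Section Triangular.
Variable n : nat.
Implicit Types (A B E F : UT L n).
Local Notation leI := (fun i j : 'I_n => (i <= j)%N).

Lemma UT_pattern A : has_pattern leI A.
Proof. by move=> i j; apply/is_UTP: i j; apply: valP. Qed.

Lemma UT_neq0 A (i j : 'I_n) : (i <= j)%N -> A i j != 0.
Proof. by rewrite UT_pattern. Qed.

Lemma UT_eq0 A (i j : 'I_n) : (j < i)%N -> A i j = 0.
Proof. by rewrite ltnNge => /(pattern0 (UT_pattern A)). Qed.

Lemma UT_mulE A B : UT_mx (A * B)%g = A *m B.
Proof. by []. Qed.

Lemma UT_mul_diag A B i : (A * B)%g i i = A i i * B i i.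
Proof.
rewrite UT_mulE mxE (bigD1 i) //= big1 ?addr0 // => k.
case: (ltngtP i k) => [/(UT_eq0 B) -> | /(UT_eq0 A) -> | /val_inj ->].
- by rewrite mulr0.
- by rewrite mul0r.
- by rewrite eqxx.
Qed.

Lemma U_diag (A : U L n) i : A i i = 1.
Proof. by have /forallP/(_ i)/eqP := valP A. Qed.

Lemma idem_diag E i : idem E -> E i i = 1.
Proof.
move=> EE; apply: idem_eq1; first exact: UT_neq0.
by rewrite -UT_mul_diag EE.
Qed.

Lemma idem_unidiagonal E : idem E -> unidiagonal E.
Proof. by move=> EE; apply/forallP => i; rewrite idem_diag. Qed.

Lemma idem_ge1 E : idem E -> 1%:M <=+ UT_mx E.
Proof.
move=> EE; apply/le_mxP => i j; rewrite mxE.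
have [-> | _] := eqVneq i j; first by rewrite idem_diag //; apply: le_add_refl.
exact: le0_add.
Qed.

Lemma idem_U (E : U L n) : idem E <-> idem (U_UT E).
Proof. by split=> [/(congr1 (@U_UT L n)) | EE] //; apply: val_inj. Qed.

Lemma UT_Fountain : Fountain (UT L n).
Proof.
have r_trans : transitive leI by move=> ? ? ?; apply: leq_trans.
have r_refl : reflexive leI by move=> i /=.
split=> A.
  have [E [rE _ EE stabE]] :=
    exists_left_stabiliser r_refl r_trans (UT_pattern A).
  have /is_UTP E_UT := rE; exists (MkUT E_UT); first exact: val_inj.
  move=> F FF; have [AE EA] := stabE F (UT_pattern F) (idem_ge1 FF).
  by split=> /(congr1 (@UT_mx L n)) eqF; apply: val_inj;
    [apply: AE | apply: EA].
have [E [rE _ EE stabE]] :=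
  exists_right_stabiliser r_refl r_trans (UT_pattern A).
have /is_UTP E_UT := rE; exists (MkUT E_UT); first exact: val_inj.
move=> F FF; have [AE EA] := stabE F (UT_pattern F) (idem_ge1 FF).
by split=> /(congr1 (@UT_mx L n)) eqF; apply: val_inj;
  [apply: AE | apply: EA].
Qed.

Lemma U_Fountain : Fountain (U L n).
Proof.
have [FR FL] := UT_Fountain.
split=> A.
  have [E EE AE] := FR (U_UT A).
  exists (MkU (idem_unidiagonal EE)); first exact/idem_U.
  move=> F /idem_U FF; have [AEF EAF] := AE _ FF.
  by split=> /(congr1 (@U_UT L n)) eqF; apply: val_inj;
    [apply: AEF | apply: EAF].
have [E EE AE] := FL (U_UT A).
exists (MkU (idem_unidiagonal EE)); first exact/idem_U.
move=> F /idem_U FF; have [AEF EAF] := AE _ FF.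
by split=> /(congr1 (@U_UT L n)) eqF; apply: val_inj;
  [apply: AEF | apply: EAF].
Qed.

End Triangular.

Lemma mkUT_subproof n (f : 'I_n -> 'I_n -> L) :
  (forall i j : 'I_n, (i <= j)%N -> f i j != 0) ->
  is_UT (\matrix_(i, j) if (i <= j)%N then f i j else 0).
Proof.
move=> f0; apply/is_UTP => i j; rewrite mxE.
by case: ifP => [/f0 | _]; rewrite ?eqxx.
Qed.

(** * Matrices of size one *)

Lemma UT1_eq (A B : UT L 1) : A 0 0 = B 0 0 -> A = B.
Proof.
by move=> AB; apply/val_inj/matrixP => i j; rewrite !ord1.
Qed.

Lemma UT1_is_group : is_group (UT L 1).
Proof.
have one0 (i j : 'I_1) : (i <= j)%N -> (1 : L) != 0 by rewrite oner_neq0.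
exists (MkUT (mkUT_subproof one0)).
  by move=> A; split; apply: UT1_eq; rewrite UT_mul_diag mxE ?mul1r ?mulr1.
move=> A; have inv0 (i j : 'I_1) : (i <= j)%N -> invL (A i j) != 0.
  by move=> ij; rewrite invL_neq0 ?UT_neq0.
exists (MkUT (mkUT_subproof inv0)).
by split; apply: UT1_eq; rewrite UT_mul_diag !mxE ?mulVL ?mulLV ?UT_neq0.
Qed.

Lemma U1_eq (A B : U L 1) : A = B.
Proof. by apply/val_inj/UT1_eq; rewrite !U_diag. Qed.

Lemma U1_is_group : is_group (U L 1).
Proof.
have [E E1 _] := UT1_is_group.
have EE : idem E by have [] := E1 E.
exists (MkU (idem_unidiagonal EE)); first by move=> A; split; apply: U1_eq.
by move=> A; exists A; split; apply: U1_eq.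
Qed.

(** * Matrices of size two *)

Lemma UT2_eq (A B : UT L 2) :
  A 0 0 = B 0 0 -> A 0 1 = B 0 1 -> A 1 1 = B 1 1 -> A = B.
Proof.
move=> e00 e01 e11; apply/val_inj/matrixP => i j.
have ord2 (k : 'I_2) : k = 0 \/ k = 1.
  by case: k => [[|[|k]] lt_k2] //; [left | right]; apply: val_inj.
by have [-> | ->] := ord2 i; have [-> | ->] := ord2 j; rewrite // !UT_eq0.
Qed.

Lemma UT2_mul01 (A B : UT L 2) :
  (A * B)%g 0 1 = A 0 0 * B 0 1 + A 0 1 * B 1 1.
Proof.
rewrite UT_mulE mxE big_ord_recl big_ord1.
by have -> : lift ord0 ord0 = 1 :> 'I_2 by apply: val_inj.
Qed.

Lemma U2_is_semilattice : is_semilattice (U L 2).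
Proof.
split=> [A B | A]; apply/val_inj/UT2_eq;
  rewrite ?U_diag // [LHS]UT2_mul01 ?[RHS]UT2_mul01 !U_diag !mul1r !mulr1.
  exact: addrC.
exact: addLL.
Qed.

Lemma UT2_regular : regular (UT L 2).
Proof.
move=> A.
have [a0 b0 d0] : [/\ A 0 0 != 0, A 0 1 != 0 & A 1 1 != 0].
  by rewrite !UT_neq0.
(* A semigroup inverse of [[a, b], [0, d]] is [[1/a, b/(ad)], [0, 1/d]]. *)
pose f (i j : 'I_2) :=
  if i == j then invL (A i i) else invL (A i i) * A i j * invL (A j j).
have f0 (i j : 'I_2) : (i <= j)%N -> f i j != 0.
  move=> ij; rewrite /f; case: ifP => _.
    by rewrite invL_neq0 ?UT_neq0.
  by rewrite !(mulL_neq0, invL_neq0, UT_neq0).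
exists (MkUT (mkUT_subproof f0)); apply: UT2_eq.
- by rewrite !UT_mul_diag mxE mulLV ?mul1r.
- rewrite 2!UT2_mul01 UT_mul_diag !mxE /= /f /= !mulrA !mulLV // !mul1r addLL.
  by rewrite -mulrA mulVL // mulr1 addLL.
- by rewrite !UT_mul_diag mxE mulLV ?mul1r.
Qed.

Lemma UT2_is_inverse : is_inverse_semigroup (UT L 2).
Proof.
apply: regular_idem_comm_inverse UT2_regular _ => E F EE FF.
have [comm _] := U2_is_semilattice.
have := comm (MkU (idem_unidiagonal EE)) (MkU (idem_unidiagonal FF)).
by move/(congr1 (@U_UT _ _)).
Qed.

(** * Matrices of size at least three *)

Section SizeAtLeastThree.
Variable m : nat.
Local Notation n := m.+3.

Let i1 : 'I_n := lift ord0 ord0.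
Let i2 : 'I_n := lift ord0 (lift ord0 ord0).

(** Diagonal [1], entry [t] at (0, 1) and [s] at all other places above the
diagonal. *)
Definition corner_entry (s t : L) (i j : 'I_n) : L :=
  if i == j then 1 else if (i == ord0) && (j == i1) then t else s.

Section Corner.
Variables s t : L.
Hypotheses (s0 : s != 0) (t0 : t != 0).

Lemma corner_entry_neq0 (i j : 'I_n) : (i <= j)%N -> corner_entry s t i j != 0.
Proof.
by rewrite /corner_entry; case: ifP => _; [rewrite oner_neq0 | case: ifP].
Qed.

Definition corner_UT : UT L n := MkUT (mkUT_subproof corner_entry_neq0).

Lemma corner_UTE (i j : 'I_n) :
  (i <= j)%N -> corner_UT i j = corner_entry s t i j.
Proof. by rewrite mxE => ->. Qed.

Lemma corner_diag i : corner_UT i i = 1.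
Proof. by rewrite corner_UTE // /corner_entry eqxx. Qed.

Lemma corner_unidiagonal : unidiagonal corner_UT.
Proof. by apply/forallP => i; rewrite corner_diag. Qed.

Definition corner : U L n := MkU corner_unidiagonal.

End Corner.

Variable g : L.
Hypotheses (g_gt1 : 1 <=+ g) (g_neq1 : g != 1).

Lemma gt1_neq0 : g != 0.
Proof. by rewrite -g_gt1 addL_neq0 ?oner_neq0. Qed.

Lemma gt1_nle1 : ~ g <=+ 1.
Proof. by move/(le_add_anti g_gt1)/esym/eqP; apply/negP. Qed.

Lemma gt1_sqr_neq0 : g * g != 0.
Proof. exact: mulL_neq0 gt1_neq0 gt1_neq0. Qed.

(* [x] and [y] differ at (0, 1) only, where they are [1] and [g]; the entries
   [g * g] above the diagonal are large enough to hide this difference in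
   [x * a] and [y * a]. *)
Let a := corner_UT gt1_neq0 gt1_neq0.
Let x := corner_UT gt1_sqr_neq0 (oner_neq0 L).
Let y := corner_UT gt1_sqr_neq0 gt1_neq0.

Let aE (i j : 'I_n) : (i < j)%N -> a i j = g.
Proof.
move=> ij; rewrite corner_UTE ?(ltnW ij) // /corner_entry -val_eqE.
by rewrite ltn_eqF ?if_same.
Qed.

Lemma not_regular_witness (b : UT L n) : (a * b * a)%g <> a.
Proof.
move=> aba; apply: gt1_nle1; apply: (le_add_pmul2r gt1_neq0); rewrite mul1r.
have b11 : b i1 i1 = 1.
  by have := congr1 (fun c : UT L n => c i1 i1) aba;
    rewrite !UT_mul_diag !corner_diag mul1r mulr1.
(* The summand [a 0 1 * b 1 1 * a 1 2 = g * g] of the (0, 2) entry of [aba] is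
   at most [a 0 2 = g]. *)
have := le_add_mulmx (a * b)%g a ord0 i1 i2.
rewrite -UT_mulE aba !aE //; apply: le_add_trans; apply: le_add_mul2r.
by have := le_add_mulmx a b ord0 i1 i1; rewrite b11 mulr1 aE.
Qed.

(** Row 0 of [y * a] differs from that of [x * a] by the summands [g * a 1 j],
which are [g] for [j = 1] and [g * g] for [j > 1]: they are absorbed by
[x 0 0 * a 0 1 = g] and by [x 0 j * a j j = g * g]. *)
Lemma not_abundant_witness_eq : (x * a = y * a)%g.
Proof.
apply/val_inj/le_add_anti.
  apply/le_mulmx2r/le_mxP => i j; rewrite !mxE; case: ifP => // _.
    rewrite /corner_entry; case: eqP => // _; first exact: le_add_refl.
    by case: ifP => // _; apply: le_add_refl.
  exact: le_add_refl.
apply/mulmx_le_addP => i k j.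
have le_xa l : x i l * a l j <=+ (x * a)%g i j by apply: le_add_mulmx.
have [/andP[/eqP i_0 /eqP k_1] | not01] :=
  boolP ((i == ord0) && (k == i1)); last first.
  suff -> : y i k = x i k by apply: le_xa.
  by rewrite !mxE /corner_entry (negPf not01).
subst i k; have -> : y ord0 i1 = g by rewrite corner_UTE.
case: j le_xa => [[|[|j]] lt_jn] le_xa.
- by rewrite (UT_eq0 a) // mulr0; apply: le0_add.
- have := le_xa ord0; rewrite aE // corner_diag mul1r.
  set j := Ordinal _; have -> : j = i1 by apply: val_inj.
  by rewrite corner_diag mulr1.
- set k := Ordinal _ in le_xa *; have := le_xa k.
  by rewrite corner_diag mulr1 aE // corner_UTE.
Qed.

(** Since [e 0 1 <= 1], the (0, 1) entry of [x * e] is at most [1], whereas that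
of [y * e] is at least [y 0 1 = g]. *)
Lemma not_abundant_witness_neq (e : UT L n) :
  idem e -> (e * a)%g = a -> (x * e)%g <> (y * e)%g.
Proof.
move=> ee ea xe_ye.
have e01 : e ord0 i1 <=+ 1.
  apply: (le_add_pmul2r gt1_neq0); rewrite mul1r.
  by have := le_add_mulmx e a ord0 i1 i2; rewrite -UT_mulE ea !aE.
apply: gt1_nle1.
have := le_add_mulmx y e ord0 i1 i1.
rewrite -UT_mulE -xe_ye idem_diag // mulr1 (corner_UTE _ _) //.
move=> /le_add_trans; apply.
rewrite mxE; apply/sum_le_addP => k.
case: k => [[|[|k]] lt_kn].
- set k := Ordinal _; have -> : k = ord0 by apply: val_inj.
  by rewrite corner_diag mul1r.
- set k := Ordinal _; have -> : k = i1 by apply: val_inj.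
  by rewrite idem_diag // mulr1 corner_UTE //; apply: le_add_refl.
- by rewrite (UT_eq0 e) // mulr0; apply: le0_add.
Qed.

Lemma UT_not_regular : ~ regular (UT L n).
Proof. by move/(_ a) => [b]; apply: not_regular_witness. Qed.

Lemma U_not_regular : ~ regular (U L n).
Proof.
move/(_ (corner gt1_neq0 gt1_neq0)) => [b /(congr1 (@U_UT L n))].
exact: not_regular_witness.
Qed.

Lemma UT_not_abundant : ~ abundant (UT L n).
Proof.
apply: (not_abundant (a := a)) => e ee ea; exists x, y.
  exact: not_abundant_witness_eq.
exact: not_abundant_witness_neq.
Qed.

Lemma U_not_abundant : ~ abundant (U L n).
Proof.
apply: (not_abundant (a := corner gt1_neq0 gt1_neq0)).
move=> e /idem_U ee /(congr1 (@U_UT L n)) ea.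
exists (corner gt1_sqr_neq0 (oner_neq0 L)), (corner gt1_sqr_neq0 gt1_neq0).
  by apply: val_inj; apply: not_abundant_witness_eq.
by move/(congr1 (@U_UT L n)); apply: not_abundant_witness_neq.
Qed.

End SizeAtLeastThree.

End Semifield.

Theorem corollary6p5 (L : linOrdIdemSemifieldType)
    (L_neq_B : exists x : L, x != 0 /\ x != 1) :
  [/\ regular (UT L 1) /\ is_group (UT L 1),
      regular (UT L 2) /\ is_inverse_semigroup (UT L 2) &
      forall n : nat, (3 <= n)%N ->
        [/\ Fountain (UT L n), ~ regular (UT L n) & ~ abundant (UT L n)]]
  /\
  [/\ regular (U L 1) /\ is_group (U L 1),
      regular (U L 2) /\ is_semilattice (U L 2) &
      forall n : nat, (3 <= n)%N ->
        [/\ Fountain (U L n), ~ regular (U L n) & ~ abundant (U L n)]].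
Proof.
have [g [g_gt1 g_neq1]] := exists_gt1 L_neq_B.
split; split.
- by split; [apply/group_regular/UT1_is_group | apply: UT1_is_group].
- by split; [apply: UT2_regular | apply: UT2_is_inverse].
- case=> [|[|[|m]]] // _; split; first exact: UT_Fountain.
    exact: UT_not_regular g_gt1 g_neq1.
  exact: UT_not_abundant g_gt1 g_neq1.
- by split; [apply/group_regular/U1_is_group | apply: U1_is_group].
- by split; [apply/semilattice_regular/U2_is_semilattice
            | apply: U2_is_semilattice].
- case=> [|[|[|m]]] // _; split; first exact: U_Fountain.
    exact: U_not_regular g_gt1 g_neq1.
  exact: U_not_abundant g_gt1 g_neq1.
Qed.
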